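(* Let $q\in(0,1)$. Then for all $x\in[1,\infty)$, $$\left(\frac{1-q^x}{1-q}\right)^{x}\exp\left(-\frac{\mathrm{Li}_2(1-q)}{\log q}\right)\exp\left(\frac{\mathrm{Li}_2(1-q^x)}{\log q}\right)\le\Gamma_q(x+1)\le\left(\frac{1-q^x}{1-q}\right)^{x+1/2}\exp\left(-\frac{\mathrm{Li}_2(1-q)}{\log q}\right)\exp\left(\frac{\mathrm{Li}_2(1-q^x)}{\log q}\right).$$
   Context: For $0<q<1$ and $x>0$, the $q$-gamma function is $\Gamma_q(x)=(1-q)^{1-x}\prod_{j=0}^{\infty}\frac{1-q^{j+1}}{1-q^{j+x}}$. The dilogarithm is $\mathrm{Li}_2(z)=-\int_0^z\frac{\log(1-t)}{t}\,dt$ for $0<z<1$. *)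

(* Defs.v *)
From Stdlib Require Import Reals.
From Coquelicot Require Import Coquelicot.
Open Scope R_scope.

(* Meaningful for 0 < q < 1 and 0 < x.  The infinite product is the limit of
   its partial products: [prod_f_R0 f n] is f 0 * ... * f n, and [Lim_seq] is
   the finite limit since the product converges for such q and x.  Powers with
   a real exponent are [Rpower], whose bases q and 1 - q are positive. *)
Definition qGamma (q x : R) : R :=
  Rpower (1 - q) (1 - x) *
  real (Lim_seq (prod_f_R0 (fun j : nat =>
    (1 - q ^ (j + 1)) / (1 - Rpower q (INR j + x))))).

(* Meaningful for 0 < z < 1.  The integrand has limit -1 at 0 and is therefore
   Riemann integrable on [0, z]; the integral does not depend on the value
   that the total division assigns to it at t = 0. *)
Definition Li2 (z : R) : R := - RInt (fun t => ln (1 - t) / t) 0 z.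

(* Main.v *)
Require Import Defs.
From Stdlib Require Import Reals Lra Lia.
From Coquelicot Require Import Coquelicot.
Open Scope R_scope.

(** Write f(t) = ln (1 - q^t).  On t > 0 it is negative, increasing and tends
    to 0 at infinity, and its derivative f' decreases and is convex.
    Substituting u = 1 - q^t in the dilogarithm shows that the logarithm
    M(x) of the lower bound satisfies M(1) = 0 and M'(x) = f(x) - f(1)
    ([is_derive_dilog_exponent]), so that M is the integral of f - f(1) from 1
    to x; the upper bound is exp (M(x) + (f(x) - f(1)) / 2).  The claim is thus
    an Euler-Maclaurin estimate for ln Gamma_q(x + 1), which equals
    - x f(1) + sum over j >= 1 of f(j) - f(j + x).

    To avoid differentiating an infinite product, only the first n + 1 terms
    of the sum are kept.  Let D_n(x) be the truncated logarithm minus M(x)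
    ([log_gap]).  Its derivative is - f(x) - sum of the f'(j + x) for
    1 <= j <= n + 1, and the sum of the f'(j + x) is compared in two ways with
    the integral of f' over [x, x + n + 1], which is f(x + n + 1) - f(x):
    - as f' decreases, the right-endpoint sum is at most the integral, hence
      D_n' >= - f(x + n + 1) >= 0 and D_n(x) >= D_n(1) >= 0
      ([log_gap_nonneg]);
    - as f' is convex, the trapezoidal sum is at least the integral, hence
      D_n - f / 2 has derivative at most - f(n + 2), which gives
      D_n(x) <= (f(x) - f(1)) / 2 - x f(n + 2) ([log_gap_le]).
    Exponentiating and letting n tend to infinity removes the error term
    x f(n + 2) and gives both inequalities ([qGamma_bounds]). *)

(** * Mean value estimates *)

Lemma exp_monotone (a b : R) : a <= b -> exp a <= exp b.
Proof. intros [h| ->]; [left; now apply exp_increasing | lra]. Qed.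

Lemma mean_value (f f1 : R -> R) (a b : R) :
  a <= b ->
  (forall t, a <= t <= b -> is_derive f t (f1 t)) ->
  exists c, a <= c <= b /\ f b - f a = f1 c * (b - a).
Proof.
intros hab hd.
destruct (MVT_gen f a b f1) as [c [hc e]].
- intros t ht; apply hd; rewrite Rmin_left, Rmax_right in ht; lra.
- intros t ht; rewrite Rmin_left, Rmax_right in ht by lra.
  apply continuity_pt_filterlim, (ex_derive_continuous f).
  exists (f1 t); apply hd; lra.
- rewrite Rmin_left, Rmax_right in hc by lra; eauto.
Qed.

Lemma derive_bounds_increment (f f1 : R -> R) (a b m M : R) :
  a <= b ->
  (forall t, a <= t <= b -> is_derive f t (f1 t)) ->
  (forall t, a <= t <= b -> m <= f1 t <= M) ->
  m * (b - a) <= f b - f a <= M * (b - a).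
Proof.
intros hab hd hb; destruct (mean_value f f1 a b hab hd) as [c [hc e]].
rewrite e; specialize (hb c hc); nra.
Qed.

Lemma derive_nonneg_le (f f1 : R -> R) (a b : R) :
  a <= b ->
  (forall t, a <= t <= b -> is_derive f t (f1 t)) ->
  (forall t, a <= t <= b -> 0 <= f1 t) ->
  f a <= f b.
Proof.
intros hab hd hb; destruct (mean_value f f1 a b hab hd) as [c [hc e]].
specialize (hb c hc); nra.
Qed.

(** With f1 convex, the trapezoidal rule overestimates the integral of f1.  As a
    function of the right endpoint t, the error has derivative
    (f1 a - f1 t + (t - a) * f2 t) / 2, which is nonnegative because the graph of
    f1 lies above its tangent at t. *)
Lemma trapezoid_convex (f f1 f2 : R -> R) (a b : R) :
  a <= b ->
  (forall t, a <= t <= b -> is_derive f t (f1 t)) ->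
  (forall t, a <= t <= b -> is_derive f1 t (f2 t)) ->
  (forall s t, a <= s <= t -> t <= b -> f2 s <= f2 t) ->
  f b - f a <= (b - a) * (f1 a + f1 b) / 2.
Proof.
intros hab d1 d2 mono.
enough ((a - a) * (f1 a + f1 a) / 2 - f a <= (b - a) * (f1 a + f1 b) / 2 - f b) by lra.
apply (derive_nonneg_le (fun t => (t - a) * (f1 a + f1 t) / 2 - f t)
  (fun t => (f1 a + f1 t + (t - a) * f2 t) / 2 - f1 t)); trivial.
- intros t ht. specialize (d1 t ht); specialize (d2 t ht).
  auto_derive.
  + repeat split; eexists; eauto.
  + replace (Derive (fun x => f1 x) t) with (f2 t) by (symmetry; now apply is_derive_unique).
    replace (Derive (fun x => f x) t) with (f1 t) by (symmetry; now apply is_derive_unique).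
    field.
- intros t ht.
  assert (f1 t - f1 a <= f2 t * (t - a)); [|lra].
  enough (f2 a * (t - a) <= f1 t - f1 a <= f2 t * (t - a)) by lra.
  apply derive_bounds_increment with f2; [lra | intros; apply d2; lra |].
  intros s hs; split; apply mono; lra.
Qed.

(** * Comparing sums of a derivative with increments *)

Section Sums.
Variables (f f1 f2 : R -> R) (x : R).
Hypothesis d1 : forall t, x <= t -> is_derive f t (f1 t).
Hypothesis d2 : forall t, x <= t -> is_derive f1 t (f2 t).

Lemma right_sum_le (mono : forall s t, x <= s <= t -> f1 t <= f1 s) (n : nat) :
  sum_f_R0 (fun j => f1 (INR (j + 1) + x)) n <= f (INR (n + 1) + x) - f x.
Proof.
assert (step : forall a, x <= a -> f1 (1 + a) <= f (1 + a) - f a).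
{ intros a ha.
  enough (f1 (1 + a) * (1 + a - a) <= f (1 + a) - f a <= f1 a * (1 + a - a)) by lra.
  apply derive_bounds_increment with f1; [lra | intros; apply d1; lra |].
  intros t ht; split; apply mono; lra. }
induction n as [|n IH].
- simpl; apply step; lra.
- rewrite tech5.
  assert (E : INR (S n + 1) + x = 1 + (INR (n + 1) + x)).
  { change (S n + 1)%nat with (S (n + 1)); rewrite S_INR; ring. }
  rewrite E.
  assert (0 <= INR (n + 1)) by apply pos_INR.
  specialize (step (INR (n + 1) + x)); lra.
Qed.

(** The first node x carries the weight 1/2 and so does the last one, whence the
    two corrections to the full sum over the nodes x + 1, ..., x + n + 1. *)
Lemma trapezoid_sum_ge (mono : forall s t, x <= s <= t -> f2 s <= f2 t) (n : nat) :
  f (INR (n + 1) + x) - f x <=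
  f1 x / 2 + sum_f_R0 (fun j => f1 (INR (j + 1) + x)) n - f1 (INR (n + 1) + x) / 2.
Proof.
assert (step : forall a, x <= a -> f (1 + a) - f a <= (f1 a + f1 (1 + a)) / 2).
{ intros a ha.
  enough (f (1 + a) - f a <= (1 + a - a) * (f1 a + f1 (1 + a)) / 2) by lra.
  apply trapezoid_convex with f2; [lra | | |]; intros;
    (apply d1 || apply d2 || apply mono); lra. }
induction n as [|n IH].
- simpl; specialize (step x); lra.
- rewrite tech5.
  assert (E : INR (S n + 1) + x = 1 + (INR (n + 1) + x)).
  { change (S n + 1)%nat with (S (n + 1)); rewrite S_INR; ring. }
  rewrite E.
  assert (0 <= INR (n + 1)) by apply pos_INR.
  specialize (step (INR (n + 1) + x)); lra.
Qed.
End Sums.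

(** * The derivative of the dilogarithm *)

(** The continuous extension of ln (1 - t) / t to t = 0: the integrability of
    the integrand of [Li2] on [0, z] comes from the continuity of this function. *)
Definition dilog_integrand (t : R) : R :=
  match Req_EM_T t 0 with left _ => -1 | right _ => ln (1 - t) / t end.

Lemma dilog_integrand_eq (t : R) : t <> 0 -> dilog_integrand t = ln (1 - t) / t.
Proof. intros h; unfold dilog_integrand; destruct (Req_EM_T t 0); tauto. Qed.

Lemma continuous_ln_quotient (t : R) :
  t < 1 -> t <> 0 -> continuous (fun t => ln (1 - t) / t) t.
Proof.
intros h1 h0; apply (ex_derive_continuous (fun t => ln (1 - t) / t)).
auto_derive; repeat split; lra.
Qed.

Lemma continuous_dilog_integrand (t : R) : t < 1 -> continuous dilog_integrand t.
Proof.
intros ht; destruct (Req_dec t 0) as [->|h0].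
- (* At 0 the quotient is the difference quotient of ln (1 - t), of derivative -1. *)
  assert (d : derivable_pt_lim (fun t => ln (1 - t)) 0 (-1)).
  { apply is_derive_Reals; auto_derive; [lra|]; field. }
  apply continuity_pt_filterlim.
  intros e he; destruct (d e he) as [delta hd].
  exists delta; split; [apply cond_pos|].
  intros y [[_ hy] hyd]; simpl in *; unfold R_dist in *.
  rewrite Rminus_0_r in hyd.
  specialize (hd y (not_eq_sym hy) hyd).
  rewrite dilog_integrand_eq by auto.
  unfold dilog_integrand; destruct (Req_EM_T 0 0); [|lra].
  rewrite Rplus_0_l, Rminus_0_r, ln_1, Rminus_0_r in hd; exact hd.
- apply continuous_ext_loc with (fun t => ln (1 - t) / t).
  + exists (mkposreal (Rabs t) (Rabs_pos_lt t h0)); intros y hy; simpl in hy.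
    rewrite dilog_integrand_eq; trivial; intros ->.
    unfold ball in hy; simpl in hy; unfold AbsRing_ball, abs, minus, plus, opp in hy; simpl in hy.
    rewrite Rplus_0_l, Rabs_Ropp in hy; lra.
  + now apply continuous_ln_quotient.
Qed.

Lemma is_derive_Li2 (z : R) : 0 < z < 1 -> is_derive Li2 z (- (ln (1 - z) / z)).
Proof.
intros hz.
rewrite <- dilog_integrand_eq by lra.
apply is_derive_ext_loc with (fun z => opp (RInt dilog_integrand 0 z)).
- assert (h0 : 0 < z) by lra.
  exists (mkposreal z h0); intros y hy; unfold Li2.
  unfold ball in hy; simpl in hy; unfold AbsRing_ball, abs, minus, plus, opp in hy; simpl in hy.
  apply Rabs_lt_between in hy.
  change (- RInt dilog_integrand 0 y = - RInt (fun t => ln (1 - t) / t) 0 y).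
  f_equal; apply RInt_ext; intros t ht.
  rewrite Rmin_left in ht by lra; apply dilog_integrand_eq; lra.
- apply (is_derive_opp (fun z => RInt dilog_integrand 0 z)).
  apply is_derive_RInt with 0; [|apply continuous_dilog_integrand; lra].
  assert (h1 : 0 < 1 - z) by lra.
  exists (mkposreal (1 - z) h1); intros y hy.
  unfold ball in hy; simpl in hy; unfold AbsRing_ball, abs, minus, plus, opp in hy; simpl in hy.
  apply Rabs_lt_between in hy.
  apply (RInt_correct dilog_integrand), (ex_RInt_continuous dilog_integrand).
  intros t [_ ht]; apply continuous_dilog_integrand.
  revert ht; apply Rmax_case; lra.
Qed.

(** * The function ln (1 - q^t) and its first two derivatives *)

Section QLog.
Variable q : R.
Hypothesis hq : 0 < q < 1.

Definition ln1q (t : R) : R := ln (1 - Rpower q t).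
Definition ln1q_d1 (t : R) : R := - ln q * Rpower q t / (1 - Rpower q t).
Definition ln1q_d2 (t : R) : R := - (ln q) ^ 2 * Rpower q t / (1 - Rpower q t) ^ 2.

Lemma ln_q_neg : ln q < 0.
Proof. rewrite <- ln_1; apply ln_increasing; lra. Qed.

Lemma Rpower_q_pos (t : R) : 0 < Rpower q t.
Proof. apply exp_pos. Qed.

Lemma Rpower_q_lt_1 (t : R) : 0 < t -> Rpower q t < 1.
Proof.
intros ht; rewrite <- exp_0; apply exp_increasing.
generalize ln_q_neg; nra.
Qed.

Lemma Rpower_q_antitone (s t : R) : s <= t -> Rpower q t <= Rpower q s.
Proof.
intros [h| ->]; [|lra].
left; apply exp_increasing; generalize ln_q_neg; nra.
Qed.

Lemma is_derive_Rpower_q (t : R) : is_derive (Rpower q) t (ln q * Rpower q t).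
Proof. unfold Rpower; auto_derive; trivial; ring. Qed.

Lemma is_derive_ln1q (t : R) : 0 < t -> is_derive ln1q t (ln1q_d1 t).
Proof.
intros ht; generalize (Rpower_q_lt_1 t ht); intros h.
unfold ln1q, ln1q_d1, Rpower in *; auto_derive; [lra|]; field; lra.
Qed.

Lemma is_derive_ln1q_d1 (t : R) : 0 < t -> is_derive ln1q_d1 t (ln1q_d2 t).
Proof.
intros ht; generalize (Rpower_q_lt_1 t ht); intros h.
unfold ln1q_d2, ln1q_d1, Rpower in *; auto_derive; [lra|]; field; lra.
Qed.

Lemma ln1q_d1_nonneg (t : R) : 0 < t -> 0 <= ln1q_d1 t.
Proof.
intros ht; generalize (Rpower_q_lt_1 t ht) (Rpower_q_pos t) ln_q_neg; intros.
apply Rdiv_le_0_compat; [nra|lra].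
Qed.

Lemma ln1q_nonpos (t : R) : 0 < t -> ln1q t <= 0.
Proof.
intros ht; generalize (Rpower_q_lt_1 t ht) (Rpower_q_pos t); intros.
rewrite <- ln_1; apply ln_le; lra.
Qed.

Lemma ln1q_monotone (s t : R) : 0 < s <= t -> ln1q s <= ln1q t.
Proof.
intros h; generalize (Rpower_q_lt_1 s (proj1 h)) (Rpower_q_antitone s t (proj2 h)); intros.
apply ln_le; lra.
Qed.

Lemma ln1q_d2_monotone (s t : R) : 0 < s <= t -> ln1q_d2 s <= ln1q_d2 t.
Proof.
intros h; generalize (Rpower_q_lt_1 s (proj1 h)) (Rpower_q_antitone s t (proj2 h))
  (Rpower_q_pos t) (Rpower_q_pos s); intros.
unfold ln1q_d2.
enough (Rpower q t / (1 - Rpower q t) ^ 2 <= Rpower q s / (1 - Rpower q s) ^ 2)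
  by (unfold Rdiv in *; generalize (pow2_ge_0 (ln q)); nra).
unfold Rdiv; apply Rmult_le_compat; [lra | left; apply Rinv_0_lt_compat, pow_lt; lra | lra |].
apply Rinv_le_contravar; [apply pow_lt; lra | apply pow_incr; lra].
Qed.

Lemma ln1q_d1_antitone (s t : R) : 0 < s <= t -> ln1q_d1 t <= ln1q_d1 s.
Proof.
intros h; generalize (Rpower_q_lt_1 s (proj1 h)) (Rpower_q_antitone s t (proj2 h))
  (Rpower_q_pos t) (Rpower_q_pos s) ln_q_neg; intros.
unfold ln1q_d1, Rdiv; apply Rmult_le_compat; [nra | left; apply Rinv_0_lt_compat; lra | nra |].
apply Rinv_le_contravar; lra.
Qed.

(** * The exponent of the lower bound *)

Definition dilog_exponent (x : R) : R :=
  x * (ln1q x - ln1q 1) + (Li2 (1 - Rpower q x) - Li2 (1 - q)) / ln q.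

(** Since ln (q^x) = x ln q, the derivative of Li2 (1 - q^x) / ln q is
    - x * ln1q_d1 x, and it cancels the term x * ln1q_d1 x that comes from
    differentiating the product. *)
Lemma is_derive_dilog_exponent (x : R) :
  0 < x -> is_derive dilog_exponent x (ln1q x - ln1q 1).
Proof.
intros hx.
generalize (Rpower_q_lt_1 x hx) (Rpower_q_pos x) ln_q_neg; intros h1 h0 hl.
assert (dL : is_derive Li2 (1 - Rpower q x) (- (ln (Rpower q x) / (1 - Rpower q x)))).
{ replace (ln (Rpower q x)) with (ln (1 - (1 - Rpower q x))) by (f_equal; ring).
  apply is_derive_Li2; lra. }
unfold Rpower at 2 in dL; rewrite ln_exp in dL.
generalize (is_derive_ln1q x hx) (is_derive_Rpower_q x); intros df dq.
unfold dilog_exponent; auto_derive.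
- repeat split; eexists; eauto.
- replace (Derive (fun x => ln1q x) x) with (ln1q_d1 x) by (symmetry; now apply is_derive_unique).
  replace (Derive (fun x => Rpower q x) x) with (ln q * Rpower q x) by (symmetry; now apply is_derive_unique).
  replace (Derive (fun x => Li2 x) (1 + - Rpower q x)) with (- (x * ln q / (1 - Rpower q x)))
    by (symmetry; now apply is_derive_unique).
  unfold ln1q_d1; field; lra.
Qed.

(** * Truncated products against the exponent *)

Definition log_qprod (n : nat) (x : R) : R :=
  sum_f_R0 (fun j => ln1q (INR (j + 1)) - ln1q (INR (j + 1) + x)) n.

Lemma is_derive_log_qprod (n : nat) (x : R) : 0 < x ->
  is_derive (log_qprod n) x (- sum_f_R0 (fun j => ln1q_d1 (INR (j + 1) + x)) n).
Proof.
intros hx; unfold log_qprod.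
assert (step : forall j, is_derive (fun x => ln1q (INR (j + 1)) - ln1q (INR (j + 1) + x)) x
   (- ln1q_d1 (INR (j + 1) + x))).
{ intros j; assert (0 <= INR (j + 1)) by apply pos_INR.
  assert (d : is_derive ln1q (INR (j + 1) + x) (ln1q_d1 (INR (j + 1) + x)))
    by (apply is_derive_ln1q; lra).
  auto_derive; [repeat split; eexists; eauto|].
  replace (Derive (fun x => ln1q x) (INR (j + 1) + x)) with (ln1q_d1 (INR (j + 1) + x))
    by (symmetry; now apply is_derive_unique).
  ring. }
induction n as [|n IH].
- apply step.
- rewrite tech5, Ropp_plus_distr.
  apply is_derive_ext with (fun x => plus
    (sum_f_R0 (fun j => ln1q (INR (j + 1)) - ln1q (INR (j + 1) + x)) n)
    (ln1q (INR (S n + 1)) - ln1q (INR (S n + 1) + x))).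
  + intros t; now rewrite tech5.
  + apply (is_derive_plus _ (fun x => ln1q (INR (S n + 1)) - ln1q (INR (S n + 1) + x))); [exact IH | apply step].
Qed.

Lemma log_qprod_1 (n : nat) : log_qprod n 1 = ln1q 1 - ln1q (INR (n + 1) + 1).
Proof.
unfold log_qprod; induction n as [|n IH].
- simpl; lra.
- rewrite tech5, IH.
  change (S n + 1)%nat with (S (n + 1)); rewrite S_INR; ring.
Qed.

Definition log_gap (n : nat) (x : R) : R := log_qprod n x - x * ln1q 1 - dilog_exponent x.

Definition log_gap_d1 (n : nat) (x : R) : R :=
  - sum_f_R0 (fun j => ln1q_d1 (INR (j + 1) + x)) n - ln1q x.

Lemma is_derive_log_gap (n : nat) (x : R) : 0 < x ->
  is_derive (log_gap n) x (log_gap_d1 n x).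
Proof.
intros hx; generalize (is_derive_log_qprod n x hx) (is_derive_dilog_exponent x hx); intros ds dd.
unfold log_gap; auto_derive; [repeat split; eexists; eauto|].
replace (Derive (fun x => log_qprod n x) x) with (- sum_f_R0 (fun j => ln1q_d1 (INR (j + 1) + x)) n)
  by (symmetry; now apply is_derive_unique).
replace (Derive (fun x => dilog_exponent x) x) with (ln1q x - ln1q 1)
  by (symmetry; now apply is_derive_unique).
unfold log_gap_d1; ring.
Qed.

Lemma log_gap_1 (n : nat) : log_gap n 1 = - ln1q (INR (n + 1) + 1).
Proof.
unfold log_gap, dilog_exponent; rewrite log_qprod_1, (Rpower_1 q) by lra.
field; generalize ln_q_neg; lra.
Qed.

(** At x = 1 the truncated product telescopes, which gives the starting value of
    the gap; then the gap increases, by the right-endpoint estimate. *)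
Lemma log_gap_nonneg (n : nat) (x : R) : 1 <= x -> 0 <= log_gap n x.
Proof.
intros hx; assert (0 <= INR (n + 1)) by apply pos_INR.
apply Rle_trans with (log_gap n 1).
- rewrite log_gap_1; generalize (ln1q_nonpos (INR (n + 1) + 1)); lra.
- apply derive_nonneg_le with (log_gap_d1 n); trivial.
  + intros t ht; apply is_derive_log_gap; lra.
  + intros t ht; unfold log_gap_d1.
    assert (h := right_sum_le ln1q ln1q_d1 t).
    generalize (ln1q_nonpos (INR (n + 1) + t)); intros.
    specialize (h ltac:(intros; apply is_derive_ln1q; lra)
                  ltac:(intros; apply ln1q_d1_antitone; lra) n); lra.
Qed.

(** By the trapezoidal estimate at t >= 1, the gap minus half of [ln1q] has slope
    at most - ln1q (n + 1 + t), hence at most - ln1q (n + 2).  Integrated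
    from 1 to x and added to the value - ln1q (n + 2) of the gap at 1, this slope
    makes up the error term - x * ln1q (n + 2). *)
Lemma log_gap_le (n : nat) (x : R) : 1 <= x ->
  log_gap n x <= (ln1q x - ln1q 1) / 2 - x * ln1q (INR (n + 1) + 1).
Proof.
intros hx; assert (0 <= INR (n + 1)) by apply pos_INR.
set (c := ln1q (INR (n + 1) + 1)).
enough (h : ln1q 1 / 2 - 1 * c - log_gap n 1 <= ln1q x / 2 - x * c - log_gap n x)
  by (rewrite log_gap_1 in h; fold c in h; lra).
apply (derive_nonneg_le (fun t => ln1q t / 2 - t * c - log_gap n t)
  (fun t => ln1q_d1 t / 2 - c - log_gap_d1 n t)); trivial.
- intros t ht.
  assert (d := is_derive_ln1q t ltac:(lra)); assert (dg := is_derive_log_gap n t ltac:(lra)).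
  auto_derive; [repeat split; eexists; eauto|].
  replace (Derive (fun x => ln1q x) t) with (ln1q_d1 t) by (symmetry; now apply is_derive_unique).
  replace (Derive (fun x => log_gap n x) t) with (log_gap_d1 n t)
    by (symmetry; now apply is_derive_unique).
  field.
- intros t ht; unfold log_gap_d1.
  assert (h := trapezoid_sum_ge ln1q ln1q_d1 ln1q_d2 t
    ltac:(intros; apply is_derive_ln1q; lra) ltac:(intros; apply is_derive_ln1q_d1; lra)
    ltac:(intros; apply ln1q_d2_monotone; lra) n).
  assert (hc := ln1q_monotone (INR (n + 1) + 1) (INR (n + 1) + t) ltac:(lra)); fold c in hc.
  generalize (ln1q_d1_nonneg (INR (n + 1) + t)); lra.
Qed.

(** * Passing to the limit *)

Lemma ln1q_lim_0 : is_lim_seq (fun n => ln1q (INR (n + 1) + 1)) 0.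
Proof.
rewrite <- ln_1.
apply (is_lim_seq_continuous ln (fun n => 1 - Rpower q (INR (n + 1) + 1)) 1).
{ apply derivable_continuous_pt; exists (/ 1); apply derivable_pt_lim_ln; lra. }
replace (Finite 1) with (Finite (1 - 0)) by (f_equal; ring).
apply is_lim_seq_minus'; [apply is_lim_seq_const|].
apply is_lim_seq_ext with (fun n => q ^ (n + 2)).
- intros n; rewrite <- Rpower_pow by lra; f_equal.
  rewrite !plus_INR; simpl; ring.
- apply (is_lim_seq_incr_n (fun n => q ^ n)), is_lim_seq_geom; rewrite Rabs_right; lra.
Qed.

Definition qprod (x : R) : nat -> R := prod_f_R0 (fun j : nat =>
    (1 - q ^ (j + 1)) / (1 - Rpower q (INR j + (x + 1)))).

Lemma qprod_exp (x : R) (n : nat) : 0 < x -> qprod x n = exp (log_qprod n x).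
Proof.
intros hx.
assert (factor : forall j, (1 - q ^ (j + 1)) / (1 - Rpower q (INR j + (x + 1))) =
  exp (ln1q (INR (j + 1)) - ln1q (INR (j + 1) + x))).
{ intros j; assert (hj : 0 < INR (j + 1)) by (apply lt_0_INR; lia).
  unfold Rminus at 3; rewrite exp_plus, exp_Ropp; unfold ln1q.
  rewrite !exp_ln by (generalize (Rpower_q_lt_1 (INR (j + 1))) (Rpower_q_lt_1 (INR (j + 1) + x)); lra).
  rewrite Rpower_pow by lra.
  replace (INR (j + 1) + x) with (INR j + (x + 1)) by (rewrite plus_INR; simpl; ring).
  reflexivity. }
unfold qprod, log_qprod; induction n as [|n IH].
- apply factor.
- cbn [prod_f_R0]; rewrite IH, factor, tech5, exp_plus; reflexivity.
Qed.

(** Each factor is at most 1, so the partial products decrease and stay positive. *)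
Lemma ex_finite_lim_qprod (x : R) : 0 < x -> ex_finite_lim_seq (qprod x).
Proof.
intros hx; apply ex_finite_lim_seq_decr with 0; intros n; rewrite !qprod_exp by trivial;
  [|left; apply exp_pos].
apply exp_monotone; unfold log_qprod; rewrite tech5.
assert (0 < INR (S n + 1)) by (apply lt_0_INR; lia).
generalize (ln1q_monotone (INR (S n + 1)) (INR (S n + 1) + x)); lra.
Qed.

Lemma qGamma_is_lim (x : R) : 0 < x ->
  is_lim_seq (fun n => exp (log_qprod n x - x * ln1q 1)) (qGamma q (x + 1)).
Proof.
intros hx.
apply is_lim_seq_ext with (fun n => Rpower (1 - q) (1 - (x + 1)) * qprod x n).
- intros n; rewrite qprod_exp by trivial; unfold Rpower; rewrite <- exp_plus.
  unfold ln1q; rewrite (Rpower_1 q) by lra; f_equal; ring.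
- apply (is_lim_seq_scal_l (qprod x) _ (real (Lim_seq (qprod x)))).
  apply Lim_seq_correct', ex_finite_lim_qprod; trivial.
Qed.

Lemma qGamma_bounds (x : R) : 1 <= x ->
  exp (dilog_exponent x) <= qGamma q (x + 1)
    <= exp (dilog_exponent x + (ln1q x - ln1q 1) / 2).
Proof.
intros hx; assert (L := qGamma_is_lim x ltac:(lra)); split.
- apply (is_lim_seq_le (fun _ => exp (dilog_exponent x)) _ _ _) with (2 := is_lim_seq_const _) (3 := L).
  intros n; apply exp_monotone; generalize (log_gap_nonneg n x hx); unfold log_gap; lra.
- apply (is_lim_seq_le _ (fun n => exp (dilog_exponent x + (ln1q x - ln1q 1) / 2
    - x * ln1q (INR (n + 1) + 1))) (qGamma q (x + 1))
    (exp (dilog_exponent x + (ln1q x - ln1q 1) / 2))) with (2 := L).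
  + intros n; apply exp_monotone; generalize (log_gap_le n x hx); unfold log_gap; lra.
  + apply (is_lim_seq_continuous exp).
    { apply derivable_continuous_pt, derivable_pt_exp. }
    replace (Finite (dilog_exponent x + (ln1q x - ln1q 1) / 2)) with
     (Finite (dilog_exponent x + (ln1q x - ln1q 1) / 2 - x * 0)) by (f_equal; ring).
    apply is_lim_seq_minus'; [apply is_lim_seq_const|].
    apply (is_lim_seq_scal_l _ x 0), ln1q_lim_0.
Qed.

End QLog.

Theorem corollary4 (q : R) (hq : 0 < q < 1) (x : R) (hx : 1 <= x) :
  Rpower ((1 - Rpower q x) / (1 - q)) x
    * exp (- (Li2 (1 - q) / ln q)) * exp (Li2 (1 - Rpower q x) / ln q)
  <= qGamma q (x + 1)
  <= Rpower ((1 - Rpower q x) / (1 - q)) (x + 1 / 2)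
    * exp (- (Li2 (1 - q) / ln q)) * exp (Li2 (1 - Rpower q x) / ln q).
Proof.
assert (E : forall y, Rpower ((1 - Rpower q x) / (1 - q)) y = exp (y * (ln1q q x - ln1q q 1))).
{ intros y; unfold Rpower at 1; do 2 f_equal.
  unfold ln1q; rewrite (Rpower_1 q) by lra; apply ln_div; [|lra].
  generalize (Rpower_q_lt_1 q hq x); lra. }
rewrite !E, <- !exp_plus.
generalize (qGamma_bounds q hq x hx); unfold dilog_exponent, Rdiv.
intros [h1 h2]; split; [eapply Rle_trans, h1 | eapply Rle_trans; [apply h2|]];
  right; f_equal; ring.
Qed.
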